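(* Let $(M,\mathcal{C})$ be a $(2n+1)$-dimensional contact manifold and let $\mathcal{D}\subset\mathcal{C}$ be an $n$-dimensional subdistribution. Assume that $\mathcal{D}^\perp$ possesses $n$ independent first integrals $f_1,\dots,f_n$. Denote $$M_{\mathcal{I}}=\bigcup_{\phi}M^{(1)}_{\phi(f_1,\dots,f_n)},$$ where $\phi$ is an arbitrary function of $n$ variables. Then $M_{\mathcal{I}}=\mathcal{E}_{\mathcal{D}}$.
   Context: $\mathcal{C}=\operatorname{Ker}\theta$ with $\theta$ a (globally defined) contact form, $\omega=d\theta|_{\mathcal{C}}$; $\mathcal{D}^\perp\subset\mathcal{C}$ is the $\omega$-orthogonal complement of $\mathcal{D}$; $M^{(1)}=\bigcup_{m\in M}\mathcal{L}(\mathcal{C}_m)$ is the bundle of Lagrangian planes of $(\mathcal{C}_m,\omega_m)$, $\pi:M^{(1)}\to M$ is the projection, and $L_{m^1}$ is the plane corresponding to $m^1\in M^{(1)}$. $\mathcal{E}_{\mathcal{D}}=\{m^1\in M^{(1)}\mid L_{m^1}\cap\mathcal{D}_{\pi(m^1)}\neq0\}$. A first integral of a distribution $\mathcal{P}$ is a function $f\in C^\infty(M)$ with $X(f)=0$ for all sections $X$ of $\mathcal{P}$; functions are independent if their differentials are linearly independent. For $f\in C^\infty(M)$, $M_f=\{m\in M\mid f(m)=0\}$ is the zero level set of $f$, viewed as a first order PDE (a hypersurface of $M$), and its prolongation is $M_f^{(1)}=\{m^1\in M^{(1)}\mid m=\pi(m^1)\in M_f,\ L_{m^1}\subseteq T_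mM_f\cap\mathcal{C}_m\}$.
   Formalization: The differentials of f_1,…,f_n are assumed linearly independent also when restricted to C at every point (otherwise the claim fails, e.g. θ=dz−p dx, D=⟨∂_p⟩, f_1=z), and φ ranges over smooth functions for which 0 is a regular value of φ(f_1,…,f_n). *)

(* Defs.v *)
From HB Require Import structures.
From mathcomp Require Import all_boot all_order all_algebra.
From mathcomp Require Import all_classical all_reals all_analysis.
Set Implicit Arguments.
Unset Strict Implicit.
Unset Printing Implicit Defensive.
Import Order.TTheory GRing.Theory Num.Theory.
Import numFieldNormedType.Exports.
Local Open Scope classical_set_scope.
Local Open Scope ring_scope.

(* C^k and C^oo on an open set A; only the values of f on A matter. *)
Fixpoint Ck (R : realType) (V W : normedModType R) (k : nat) (A : set V)
    (f : V -> W) : Prop :=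
  match k with
  | 0 => forall x, A x -> {for x, continuous f}
  | j.+1 => (forall x, A x -> differentiable f x) /\
            (forall v : V, Ck j A (fun x => 'D_v f x))
  end.

Definition smooth (R : realType) (V W : normedModType R) (A : set V)
    (f : V -> W) : Prop :=
  forall k, Ck k A f.

(* [cmap] and [cinv] are total; they are meaningful on [cdom] and [cimg]. *)
Record chart (R : realType) (N : nat) (M : topologicalType) := Chart {
  cdom : set M;
  cimg : set 'rV[R]_N;
  cmap : M -> 'rV[R]_N;
  cinv : 'rV[R]_N -> M;
  cdom_open : open cdom;
  cimg_open : open cimg;
  cmap_img : forall m, cdom m -> cimg (cmap m);
  cinv_dom : forall x, cimg x -> cdom (cinv x);
  cmapK : forall m, cdom m -> cinv (cmap m) = m;
  cinvK : forall x, cimg x -> cmap (cinv x) = x;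
  cmap_continuous : forall m, cdom m -> {for m, continuous cmap};
  cinv_continuous : forall x, cimg x -> {for x, continuous cinv}
}.

Record manifold (R : realType) (N : nat) := Manifold {
  pts :> topologicalType;
  pts_hausdorff : hausdorff_space pts;
  pts_second_countable : @second_countable pts;
  atlas : set (chart R N pts);
  atlas_cover : forall m : pts, exists2 c, atlas c & cdom c m;
  atlas_compat : forall c c', atlas c -> atlas c' ->
    smooth (cimg c `&` cinv c @^-1` cdom c') (cmap c' \o cinv c)
}.

Section Calculus.
Variables (R : realType) (N : nat) (M : manifold R N).

(* A preferred chart around each point. The tangent space T_m M is 'rV[R]_N
   for every m: the row v stands for \sum_i v_i (d/dx^i)_m, where the x^i are
   the coordinates of [chart_at m]. Hence vector fields are functions
   M -> 'rV[R]_N, and they must be converted from the preferred charts to one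
   fixed chart before their smoothness makes sense. *)
Definition chart_at (m : M) : chart R N M := sval (cid2 (atlas_cover m)).

Definition differential (W : normedModType R) (f : M -> W) (m : M) :
    'rV[R]_N -> W :=
  'd (f \o cinv (chart_at m)) (cmap (chart_at m) m).

Definition smooth_on (W : normedModType R) (U : set M) (f : M -> W) : Prop :=
  forall c, atlas c -> smooth (cimg c `&` cinv c @^-1` U) (f \o cinv c).

Definition smooth_vector_field (U : set M) (X : M -> 'rV[R]_N) : Prop :=
  forall c, atlas c ->
    smooth (cimg c `&` cinv c @^-1` U)
      (fun x => differential (cmap c) (cinv c x) (X (cinv c x))).

Definition one_form := M -> 'Hom('rV[R]_N, R^o).

(* The pullback of theta by the parametrization [cinv c], at x : cimg c. *)
Definition pullback (theta : one_form) (c : chart R N M)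
    (x v : 'rV[R]_N) : R^o :=
  theta (cinv c x) ('d (cmap (chart_at (cinv c x)) \o cinv c) x v).

Definition smooth_form (theta : one_form) : Prop :=
  forall c v, atlas c -> smooth (cimg c) (fun x => pullback theta c x v).

(* (d theta)_m (u, v), by d theta (u, v) = u (theta v) - v (theta u) for the
   fields u, v that are constant in [chart_at m], whose bracket is 0. *)
Definition ext_deriv (theta : one_form) (m : M) (u v : 'rV[R]_N) : R^o :=
  let c := chart_at m in
  'D_u (fun x => pullback theta c x v) (cmap c m)
  - 'D_v (fun x => pullback theta c x u) (cmap c m).

Definition is_distribution (k : nat) (D : M -> {vspace 'rV[R]_N}) : Prop :=
  (forall m, \dim (D m) = k) /\
  (forall m, exists (U : set M) (X : 'I_k -> M -> 'rV[R]_N),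
    [/\ open U, U m, forall i, smooth_vector_field U (X i) &
        forall p, U p -> D p = <<[seq X i p | i <- enum 'I_k]>>%VS]).

(* Sections are smooth sections over arbitrary open subsets of M. *)
Definition section_of (P : M -> set 'rV[R]_N) (U : set M)
    (X : M -> 'rV[R]_N) : Prop :=
  smooth_vector_field U X /\ forall m, U m -> P m (X m).

Definition first_integral (P : M -> set 'rV[R]_N) (f : M -> R^o) : Prop :=
  smooth_on setT f /\
  forall U X, open U -> section_of P U X ->
    forall m, U m -> differential f m (X m) = 0.

(* Linear independence, at every point, of the restrictions to P of the
   differentials of the f_i. *)
Definition independent_along (P : M -> {vspace 'rV[R]_N}) (k : nat)
    (f : 'I_k -> M -> R^o) : Prop :=
  forall (m : M) (a : 'I_k -> R),
    (forall v, v \in P m -> \sum_(i < k) a i * differential (f i) m v = 0) ->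
    forall i, a i = 0.

Definition independent (k : nat) (f : 'I_k -> M -> R^o) : Prop :=
  independent_along (fun=> fullv) f.

Definition zero_set (f : M -> R^o) : set M := [set m | f m = 0].

(* The equation f = 0 defines a hypersurface: 0 is a regular value of f.
   Then T_m (zero_set f) is the kernel of the differential of f at m. *)
Definition is_hypersurface (f : M -> R^o) : Prop :=
  forall m, zero_set f m -> exists v, differential f m v != 0.

Definition tangent_zero_set (f : M -> R^o) (m : M) : set 'rV[R]_N :=
  [set v | differential f m v = 0].

End Calculus.

Record contact_manifold (R : realType) (n : nat) := ContactManifold {
  cmanifold :> manifold R n.*2.+1;
  theta : one_form cmanifold;
  theta_smooth : smooth_form theta;
  theta_neq0 : forall m, theta m != 0;
  theta_nondegenerate : forall m u, u \in lker (theta m) ->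
    (forall v, v \in lker (theta m) -> ext_deriv theta m u v = 0) -> u = 0
}.

Section Contact.
Variables (R : realType) (n : nat) (M : contact_manifold R n).
Local Notation T := 'rV[R]_(n.*2.+1).

Definition contact_dist (m : M) : {vspace T} := lker (theta m).

(* Only used on vectors of [contact_dist m]. *)
Definition omega (m : M) (u v : T) : R := ext_deriv (@theta R n M) m u v.

Definition orth (D : M -> {vspace T}) (m : M) : set T :=
  [set u | u \in contact_dist m /\ forall v, v \in D m -> omega m u v = 0].

Definition lagrangian (m : M) (L : {vspace T}) : Prop :=
  [/\ (L <= contact_dist m)%VS, \dim L = n &
      forall u v, u \in L -> v \in L -> omega m u v = 0].

(* M^(1); [proj] is the projection and [plane] the Lagrangian plane. *)
Record prolong := Prolong {
  proj : M;
  plane : {vspace T};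
  plane_lagrangian : lagrangian proj plane
}.

Definition pde_of_dist (D : M -> {vspace T}) : set prolong :=
  [set m1 | (plane m1 :&: D (proj m1))%VS <> 0%VS].

Definition prolong_zero_set (f : M -> R^o) : set prolong :=
  [set m1 | zero_set f (proj m1) /\
            forall v, v \in plane m1 ->
              tangent_zero_set f (proj m1) v /\ v \in contact_dist (proj m1)].

Definition compose_row (phi : 'rV[R]_n -> R^o) (f : 'I_n -> M -> R^o) :
    M -> R^o :=
  fun m => phi (\row_i f i m).

(* The union is over the smooth phi such that phi(f_1, ..., f_n) = 0 is a
   hypersurface; phi = 0, for one, is excluded. *)
Definition union_prolong (f : 'I_n -> M -> R^o) : set prolong :=
  \bigcup_(phi in [set phi : 'rV[R]_n -> R^o |
                    smooth setT phi /\ is_hypersurface (compose_row phi f)])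
    prolong_zero_set (compose_row phi f).

End Contact.

(* Main.v *)
Require Import Defs.
From HB Require Import structures.
From mathcomp Require Import all_boot all_order all_algebra.
From mathcomp Require Import all_classical all_reals all_analysis.
Import Order.TTheory GRing.Theory Num.Theory.
Import numFieldNormedType.Exports.
Local Open Scope classical_set_scope.
Local Open Scope ring_scope.
Set Implicit Arguments.
Unset Strict Implicit.
Unset Printing Implicit Defensive.

(** Fix a point m. The first integrals f_i kill every section of the complement
    of D, hence (see below) every vector of the complement at m. A linear form
    which vanishes on the complement of D_m restricts to the contact plane as
    omega(d, -) for some d in D_m ([annihilator_orth]). So the restriction of
    df_i to the contact plane is omega(d_i, -), where d_i is the Hamiltonian
    vector of f_i, and since the n restrictions are independent, the d_i form a
    basis of D_m.

    Let L be a Lagrangian plane at m. If L lies in the prolongation of the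
    equation phi(f_1, ..., f_n) = 0, then the differential of the left-hand side
    is sum a_i df_i with a nonzero by regularity, and its vanishing on L says
    that d = sum a_i d_i is orthogonal to L. As L is maximal isotropic
    ([lagrangian_maximal]), d belongs to L, and d is a nonzero vector of D_m.
    Conversely a nonzero d = sum a_i d_i common to L and D_m is orthogonal to L,
    that is, sum a_i df_i vanishes on L, and phi can be taken affine with
    coefficients a_i, vanishing at (f_1(m), ..., f_n(m)).

    The analytic point is that f_i kills each vector u of the complement of D_m,
    whereas a first integral is tested on smooth sections only. One must extend u
    to a smooth section ([orth_section]). In one fixed chart, the complement is
    the space of solutions of n + 1 independent linear equations with smooth
    coefficients, and a solution at m is extended by Cramer's rule with the
    denominators cleared ([smooth_kernel_extension]). On the other hand the form
    omega is given, at each point, in a chart which depends on that point.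
    Comparing it with the fixed chart is the naturality of the exterior
    derivative ([chart_dform_change]), which rests on the symmetry of second
    derivatives ([derive_sym]). *)

(** * Calculus of functions of class C^k *)

Section CkCalculus.
Variable R : realType.
Implicit Types V W : normedModType R.

Lemma near_eq_differentiable V W (f g : V -> W) (x : V) :
  (\forall y \near x, f y = g y) -> differentiable f x -> differentiable g x.
Proof.
move=> fg df; pose h := g - f.
have h0 : \forall y \near x, h y = 0.
  by apply: filterS fg => y fgy; rewrite /h !fctE fgy subrr.
suff dh : differentiable h x.
  rewrite (_ : g = h + f); first exact: differentiableD.
  by apply/funext => y; rewrite /h !fctE subrK.
have hx : h x = 0 by exact: nbhs_singleton h0.
have eqo : h \o shift x = cst (h x) + (\0 : V -> W) +o_ 0 id.
  apply/eqaddoP => _/posnumP[e].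
  have : \forall y \near (0 : V), h (y + x) = 0.
    by rewrite (near_shift 0 x) in h0; apply: filterS h0 => y; rewrite /= subr0.
  apply: filterS => y hy.
  rewrite [X in `|X|](_ : _ = 0); first by rewrite normr0 mulr_ge0.
  by rewrite !fctE /= hy hx /cst /= addr0 subrr.
apply/diff_locallyP.
have c0 : continuous (\0 : {linear V -> W}) by move=> ?; exact: cst_continuous.
by rewrite (diff_unique c0 eqo); split.
Qed.

Lemma near_open V (A : set V) (P : V -> Prop) x :
  open A -> (forall y, A y -> P y) -> A x -> \forall y \near x, P y.
Proof. by move=> oA AP Ax; apply: filterS AP _; exact: open_nbhs_nbhs. Qed.

Lemma Ck_sub V W k (A B : set V) (f : V -> W) :
  A `<=` B -> Ck k B f -> Ck k A f.
Proof.
move=> AB; elim: k f => [|k IH] f /=; first by move=> cf x /AB; exact: cf.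
by move=> [df Df]; split=> [x /AB|v]; [exact: df|exact: IH].
Qed.

(** Openness matters: the derivatives of [f] at a point of [A] see the values
    of [f] around that point. *)
Lemma Ck_eq V W k (A : set V) (f g : V -> W) :
  open A -> (forall x, A x -> f x = g x) -> Ck k A f -> Ck k A g.
Proof.
move=> oA; elim: k f g => [|k IH] f g fg /=.
  move=> cf x Ax; suff : g @ x --> g x by []; rewrite -(fg x Ax).
  apply: cvg_trans (cf x Ax); apply: near_eq_cvg.
  exact: near_open Ax.
move=> [df Df]; split=> [x Ax|v].
  by apply: near_eq_differentiable (df x Ax); exact: near_open Ax.
apply: IH (Df v) => x Ax; apply: near_eq_derive; exact: near_open Ax.
Qed.

Lemma CkS V W k (A : set V) (f : V -> W) : Ck k.+1 A f -> Ck k A f.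
Proof.
elim: k f => [|k IH] f [df Df].
  by move=> x Ax; apply: differentiable_continuous; exact: df.
by split=> // v; apply: IH.
Qed.

Lemma Ck_cst V W k (A : set V) (c : W) : Ck k A (fun=> c).
Proof.
elim: k c => [|k IH] c /=; first by move=> x _; exact: cst_continuous.
split=> [x _|v]; first exact: differentiable_cst.
have -> : (fun x => 'D_v (fun=> c : W) x) = (fun=> 0 : W).
  by apply/funext => x; exact: derive_cst.
exact: IH.
Qed.

Lemma Ck_add V W k (A : set V) (f g : V -> W) : open A ->
  Ck k A f -> Ck k A g -> Ck k A (fun x => f x + g x).
Proof.
move=> oA; elim: k f g => [|k IH] f g /=.
  by move=> cf cg x Ax; apply: continuousD; [exact: cf|exact: cg].
move=> [df Df] [dg Dg]; split=> [x Ax|v].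
  by apply: differentiableD; [exact: df|exact: dg].
apply: Ck_eq (IH _ _ (Df v) (Dg v)) => // x Ax.
by rewrite deriveD //; apply: diff_derivable; [exact: df|exact: dg].
Qed.

Lemma Ck_lin V W W' k (A : set V) (L : W -> W') (f : V -> W) :
  linear L -> continuous L -> open A -> Ck k A f -> Ck k A (fun x => L (f x)).
Proof.
move=> linL cL oA.
pose LM := GRing.isLinear.Build _ _ _ _ L linL.
pose LL : {linear W -> W'} := HB.pack L LM.
elim: k f => [|k IH] f /=.
  by move=> cf x Ax; apply: continuous_comp; [exact: cf|exact: cL].
have dL y : differentiable L y by exact: (@linear_differentiable _ _ _ LL).
move=> [df Df]; split=> [x Ax|v].
  by apply: differentiable_comp => //; exact: df.
apply: Ck_eq (IH _ (Df v)) => // x Ax.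
have dfx := df x Ax.
have dLf : differentiable (L \o f) x by exact: differentiable_comp.
rewrite [RHS](deriveE _ dLf) (deriveE _ dfx) (diff_comp dfx (dL _)).
have E : 'd L (f x) = L :> (W -> W') by exact: (@diff_lin _ _ _ LL).
by rewrite /= E.
Qed.

Lemma scale_bilinear W : bilinear_for
  (GRing.Scale.Law.clone _ _ *:%R _) (GRing.Scale.Law.clone _ _ *:%R _)
  (fun (a : R^o) (w : W) => a *: w).
Proof.
split=> [u'|u] a x y /=.
- by rewrite scalerDl scalerA.
- by rewrite scalerDr scalerA [u * a]mulrC -scalerA.
Qed.

(** Leibniz rule, from the continuity of the bilinear map scaling a vector. *)
Lemma scale_rule V W (f : V -> R^o) (g : V -> W) x :
  differentiable f x -> differentiable g x ->
  differentiable (fun y => f y *: g y) x /\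
  forall v, 'D_v (fun y => f y *: g y) x = f x *: 'D_v g x + 'D_v f x *: g x.
Proof.
move=> df dg.
pose sM := bilinear_isBilinear.Build R R^o W W _ _ _ (@scale_bilinear W).
pose s : {bilinear R^o -> W -> W} := HB.pack (fun (a : R^o) (w : W) => a *: w) sM.
have cs : continuous (fun p : R^o * W => s p.1 p.2).
  by move=> p; exact: scale_continuous.
have dp := differentiable_pair df dg.
have ds := differentiable_bilin (f x, g x) cs.
have E : (fun y => f y *: g y) = (fun p => s p.1 p.2) \o (fun y => (f y, g y)).
  by [].
have d : differentiable (fun y => f y *: g y) x.
  by rewrite E; exact: differentiable_comp.
split=> // v; rewrite !deriveE // E (diff_comp dp ds).
have D1 := diff_bilin (f x, g x) cs; have D2 := diff_pair df dg.
by rewrite [LHS]/= D2 D1.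
Qed.

Lemma Ck_scale V W k (A : set V) (f : V -> R^o) (g : V -> W) : open A ->
  Ck k A f -> Ck k A g -> Ck k A (fun x => f x *: g x).
Proof.
move=> oA; elim: k f g => [|k IH] f g Cf Cg.
  by move=> x Ax; apply: continuousZ; [exact: Cf|exact: Cg].
have [[df Df] [dg Dg]] := (Cf, Cg); split=> [x Ax|v].
  by apply: (proj1 (scale_rule _ _)); [exact: df|exact: dg].
have H := Ck_add oA (IH _ _ (CkS Cf) (Dg v)) (IH _ _ (Df v) (CkS Cg)).
apply: Ck_eq H => // x Ax.
by rewrite (proj2 (scale_rule (df x Ax) (dg x Ax))).
Qed.

Lemma Ck_mul V k (A : set V) (f g : V -> R) : open A ->
  Ck k A (f : V -> R^o) -> Ck k A (g : V -> R^o) ->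
  Ck k A (fun x => f x * g x : R^o).
Proof. by move=> oA Cf Cg; exact: (@Ck_scale _ R^o _ _ f g). Qed.

Lemma Ck_sum V W k (A : set V) (I : Type) (r : seq I) (F : I -> V -> W) :
  open A -> (forall i, Ck k A (F i)) -> Ck k A (fun x => \sum_(i <- r) F i x).
Proof.
move=> oA CF; elim: r => [|i r IH].
  by under eq_fun do rewrite big_nil; exact: Ck_cst.
by under eq_fun do rewrite big_cons; exact: Ck_add.
Qed.

Lemma Ck_prod V k (A : set V) (I : Type) (r : seq I) (F : I -> V -> R^o) :
  open A -> (forall i, Ck k A (F i)) ->
  Ck k A (fun x => \prod_(i <- r) F i x : R^o).
Proof.
move=> oA CF; elim: r => [|i r IH].
  by under eq_fun do rewrite big_nil; exact: Ck_cst.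
by under eq_fun do rewrite big_cons; exact: Ck_scale.
Qed.

Lemma Ck_coord V N k (A : set V) (f : V -> 'rV[R]_N) j : open A ->
  Ck k A f -> Ck k A (fun x => f x 0 j : R^o).
Proof.
move=> oA; apply: (@Ck_lin _ _ _ _ _ (fun w : 'rV[R]_N => w 0 j : R^o)) => //.
- by move=> a u w; rewrite !mxE.
- by move=> w; exact: coord_continuous.
Qed.

Lemma Ck_id V k (A : set V) : Ck k A (fun x : V => x).
Proof.
case: k => [x _|k]; first exact: cvg_id.
split=> [x _|v]; first exact: ex_diff.
rewrite (_ : 'D_v (fun x : V => x) = fun=> v); first exact: Ck_cst.
by apply/funext => x; exact: derive_id.
Qed.

Lemma derive_coord V N (f : V -> 'rV[R]_N) (x v : V) j : differentiable f x ->
  'D_v (fun y => f y 0 j : R^o) x = ('D_v f x) 0 j.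
Proof. by move=> df; rewrite derive_mx ?mxE //; exact: diff_derivable. Qed.

Lemma diff_row_sum N W (h : 'rV[R]_N -> W) y v : differentiable h y ->
  'd h y v = \sum_j v 0 j *: 'D_(delta_mx 0 j) h y.
Proof.
move=> dh; rewrite {1}[v]row_sum_delta linear_sum.
by apply: eq_bigr => j _; rewrite linearZ deriveE.
Qed.

(** By the chain rule the derivative of the composite along [v] is the sum over
    [j] of the [j]-th coordinate of ['D_v f] times the partial derivative
    ['D_(delta_mx 0 j) g] composed with [f], and the partial derivatives of
    [g] are one order less smooth than [g]: induction on the order applies. *)
Lemma Ck_comp V W N k (A : set V) (B : set 'rV[R]_N) (f : V -> 'rV[R]_N)
    (g : 'rV[R]_N -> W) :
  open A -> (forall x, A x -> B (f x)) -> Ck k A f -> Ck k B g ->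
  Ck k A (g \o f).
Proof.
move=> oA AB; elim: k g => [|k IH] g Cf Cg.
  by move=> x Ax; apply: continuous_comp; [exact: Cf|apply: Cg; exact: AB].
have [[df Df] [dg Dg]] := (Cf, Cg); split=> [x Ax|v].
  by apply: differentiable_comp; [exact: df|apply: dg; exact: AB].
have H : Ck k A (fun x => \sum_j ('D_v f x) 0 j *:
    (('D_(delta_mx 0 j) g) \o f) x).
  apply: Ck_sum => // j; apply: Ck_scale => //; last exact: IH (CkS Cf) (Dg _).
  by apply: Ck_coord => //; exact: Df.
apply: Ck_eq H => // x Ax.
have dgx := dg _ (AB _ Ax).
rewrite [RHS]deriveE; last by apply: differentiable_comp => //; exact: df.
rewrite diff_comp //; last exact: df.
by rewrite /= diff_row_sum // -deriveE //; exact: df.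
Qed.

End CkCalculus.

Lemma derive_affine_row (R : realType) (N : nat) (a k : 'I_N -> R)
    (y v : 'rV[R]_N) :
  'D_v (fun z : 'rV[R]_N => \sum_j a j * (z 0 j - k j) : R^o) y =
  \sum_j a j * v 0 j.
Proof.
pose g j (z : 'rV[R]_N) : R^o := z 0 j - k j.
have dcoord j : differentiable (fun z : 'rV[R]_N => z 0 j : R^o) y.
  exact: differentiable_coord.
have dcst j : differentiable (cst (k j : R^o)) y by exact: differentiable_cst.
have dg j : differentiable (g j) y by exact: differentiableB.
have Dg j : 'D_v (g j) y = v 0 j.
  have := @deriveB R _ R^o _ _ y v (diff_derivable (dcoord j)) (diff_derivable (dcst j)).
  move=> H; apply: etrans H _.
  have did : differentiable (fun z : 'rV[R]_N => z) y by exact: ex_diff.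
  by rewrite derive_cst subr0 (derive_coord v j did) derive_id.
pose G j (z : 'rV[R]_N) : R^o := (a j : R^o) *: g j z.
have DG j := scale_rule (differentiable_cst (a j : R^o) y) (dg j).
have -> : (fun z : 'rV[R]_N => \sum_j a j * (z 0 j - k j) : R^o) = \sum_j G j.
  by apply/funext => z; rewrite fct_sumE.
rewrite derive_sum; last by move=> j; apply: diff_derivable; exact: (DG j).1.
apply: eq_bigr => j _; apply: etrans ((DG j).2 v) _.
by rewrite derive_cst scale0r addr0 Dg.
Qed.

(** * Symmetry of second derivatives *)

Section Schwarz.
Variable R : realType.
Variable V : normedModType R.

Lemma is_derive_line (W : normedModType R) (h : V -> W) (y u : V) (t : R) :
  differentiable h (y + t *: u) ->
  is_derive t (1 : R) (fun t : R => h (y + t *: u)) ('D_u h (y + t *: u)).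
Proof.
move=> dh.
have L : is_diff t (fun t : R => y + t *: u) (fun s => s *: u).
  have -> : (fun s => s *: u) = 0 + (fun s : R => s *: u).
    by apply/funext => s; rewrite fctE add0r.
  exact: (is_diffD (is_diff_cst y t) (is_diff_scalel t u)).
have dL := @ex_diff _ _ _ _ _ _ _ L.
have dc : differentiable (h \o (fun t : R => y + t *: u)) t.
  exact: differentiable_comp.
apply: DeriveDef; first exact: diff_derivable.
rewrite deriveE // diff_comp // /= deriveE //.
by rewrite (@diff_val _ _ _ _ _ _ _ L) scale1r.
Qed.

Lemma derive_translate (W : normedModType R) (h : V -> W) (a y u : V) :
  'D_u (fun z => h (z + a)) y = 'D_u h (y + a).
Proof.
rewrite /derive.
have -> // : (fun k : R => k^-1 *: (((fun z => h (z + a)) \o shift y) (k *: u)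
    - h (y + a))) =
  (fun k : R => k^-1 *: ((h \o shift (y + a)) (k *: u) - h (y + a))).
by apply/funext => k /=; rewrite addrA.
Qed.

Lemma mean_value_line (h : V -> R^o) (y u : V) (r : R) : 0 < r ->
  (forall t : R, 0 <= t <= r -> differentiable h (y + t *: u)) ->
  exists2 t : R, 0 <= t <= r & h (y + r *: u) - h y = r * 'D_u h (y + t *: u).
Proof.
move=> r0 dh.
have D (t : R) : 0 <= t <= r ->
  is_derive t (1 : R) (fun t : R => h (y + t *: u) : R) ('D_u h (y + t *: u)).
  by move=> t0r; apply: is_derive_line; exact: dh.
have [|/=|t tr E] := @MVT R (fun t : R => h (y + t *: u) : R)
    (fun t => 'D_u h (y + t *: u)) 0 r r0.
- by move=> t; rewrite in_itv /= => /andP[t0 tr]; apply: D; rewrite !ltW.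
- apply: derivable_within_continuous => t; rewrite in_itv /= => /D Dt.
  exact: (@ex_derive _ _ _ _ _ _ _ Dt).
exists t; first by move: tr; rewrite in_itv /= => /andP[? ?]; rewrite !ltW.
by move: E; rewrite scale0r addr0 subr0 mulrC.
Qed.

(** The mean value theorem, once in the direction [u] for the increment of [g]
    along [r *: v], then once in the direction [v] for ['D_u g]. The second
    difference itself is symmetric in [u] and [v]. *)
Lemma second_difference (A : set V) (g : V -> R^o) (x u v : V) (r : R) :
  Ck 2 A g -> 0 < r ->
  (forall s t : R, 0 <= s <= r -> 0 <= t <= r -> A (x + s *: u + t *: v)) ->
  exists s t : R, [/\ 0 <= s <= r, 0 <= t <= r &
    g (x + r *: u + r *: v) - g (x + r *: u) - g (x + r *: v) + g x =
    r * (r * 'D_v ('D_u g) (x + s *: u + t *: v))].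
Proof.
move=> [dg Dg] r0 Ast.
have r00 : 0 <= (0:R) <= r by rewrite lexx ltW.
have rr : 0 <= r <= r by rewrite lexx ltW.
pose h y := g (y + r *: v) - g y.
have dsh y : A (y + r *: v) -> differentiable (fun y => g (y + r *: v)) y.
  move=> Ay; apply: (@differentiable_comp _ _ _ _ (fun y => y + r *: v) g).
    exact: differentiableD.
  exact: dg.
have [t t0r|s s0r Es] := @mean_value_line h x u r r0.
  have At := Ast t 0 t0r r00; rewrite scale0r addr0 in At.
  apply: differentiableB; last exact: dg.
  by apply: dsh; exact: Ast.
have As := Ast s 0 s0r r00; rewrite scale0r addr0 in As.
have Dh : 'D_u h (x + s *: u) =
  'D_u g (x + s *: u + r *: v) - 'D_u g (x + s *: u).
  have dsh' := dsh _ (Ast s r s0r rr).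
  rewrite /h deriveB; [|exact: diff_derivable|apply: diff_derivable; exact: dg].
  by rewrite derive_translate.
have [t t0r|t t0r Et] := @mean_value_line ('D_u g) (x + s *: u) v r r0.
  by have [dDu _] := Dg u; apply: dDu; exact: Ast.
exists s, t; split => //.
by rewrite -Et -Dh -Es /h opprB [RHS]addrA [RHS]addrAC.
Qed.

(** Both functions take, up to the factor [r ^+ 2], the same value [S r] at
    some points of squares of side [r] that shrink to [x]; continuity at [x]
    then forces them to agree there. *)
Lemma eq_of_mean_values_on_squares (A : set V) (Duv Dvu : V -> R^o) (S : R -> R)
    (x u v : V) :
  open A -> A x -> {for x, continuous Duv} -> {for x, continuous Dvu} ->
  (forall r : R, 0 < r ->
    (forall s t : R, 0 <= s <= r -> 0 <= t <= r -> A (x + s *: u + t *: v)) ->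
    exists s t : R, [/\ 0 <= s <= r, 0 <= t <= r &
      S r = r * (r * Dvu (x + s *: u + t *: v))]) ->
  (forall r : R, 0 < r ->
    (forall s t : R, 0 <= s <= r -> 0 <= t <= r -> A (x + s *: v + t *: u)) ->
    exists s t : R, [/\ 0 <= s <= r, 0 <= t <= r &
      S r = r * (r * Duv (x + s *: v + t *: u))]) ->
  Duv x = Dvu x.
Proof.
move=> oA Ax cuv cvu SDuv SDvu.
apply/eqP; rewrite -subr_eq0 -normr_le0; apply/ler_addgt0Pr => e e0.
rewrite add0r.
have e2 : 0 < e / 2 by rewrite divr_gt0.
have N1 : \forall y \near x, `|Duv x - Duv y| < e / 2.
  by move: cuv => /cvgrPdist_lt /(_ _ e2).
have N2 : \forall y \near x, `|Dvu x - Dvu y| < e / 2.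
  by move: cvu => /cvgrPdist_lt /(_ _ e2).
have N3 : \forall y \near x, A y by exact: open_nbhs_nbhs.
have [d /= d0 Bd] := (nbhs_ballP _ _).1 (filterI N1 (filterI N2 N3)).
(* The square of side [r] at [x] lies in the ball of radius [d]; the summand
   1 makes the denominator positive and the inclusion strict. *)
pose r := d / (`|u| + `|v| + 1).
have c0 : 0 < `|u| + `|v| + 1 by rewrite ltr_wpDl // addr_ge0.
have r0 : 0 < r by rewrite divr_gt0.
have near_x (p q : V) (s t : R) : `|p| + `|q| = `|u| + `|v| ->
    0 <= s <= r -> 0 <= t <= r -> ball x d (x + s *: p + t *: q).
  move=> pq /andP[s0 sr] /andP[t0 tr].
  rewrite -ball_normE /= -addrA opprD addNKr normrN.
  apply: (le_lt_trans (ler_normD _ _)); rewrite !normrZ !ger0_norm //.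
  apply: (@le_lt_trans _ _ (r * (`|u| + `|v|))).
    by rewrite -pq mulrDr lerD // ler_wpM2r.
  by rewrite /r mulrAC ltr_pdivrMr // ltr_pM2l // ltrDl.
have [|s [t [s0 t0 E1]]] := SDuv r r0.
  by move=> s t s0 t0; apply: (proj2 (proj2 (Bd _ _))); exact: near_x.
have [|s' [t' [s0' t0' E2]]] := SDvu r r0.
  move=> s' t' s0' t0'; apply: (proj2 (proj2 (Bd _ _))).
  by apply: near_x => //; rewrite addrC.
have E : Dvu (x + s *: u + t *: v) = Duv (x + s' *: v + t' *: u).
  apply: (mulfI (lt0r_neq0 r0)); apply: (mulfI (lt0r_neq0 r0)).
  by rewrite -E1 -E2.
have [_ [B1 _]] := Bd _ (near_x u v s t erefl s0 t0).
have [B2 _] := Bd _ (near_x v u s' t' (addrC _ _) s0' t0').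
rewrite E in B1.
apply: le_trans (ler_distD (Duv (x + s' *: v + t' *: u)) _ _) _.
by rewrite (splitr e) lerD // ltW // distrC.
Qed.

(** Schwarz's theorem: computing the second difference in the two orders gives
    the same value to [r ^+ 2] times each of the mixed derivatives, at points of
    the square. *)
Lemma derive_sym_real (A : set V) (g : V -> R^o) (x u v : V) :
  open A -> A x -> Ck 2 A g -> 'D_u ('D_v g) x = 'D_v ('D_u g) x.
Proof.
move=> oA Ax Cg; have [_ Dg] := Cg.
have [_ /(_ u) cuv] := Dg v; have [_ /(_ v) cvu] := Dg u.
apply: (@eq_of_mean_values_on_squares A _ _ (fun r => g (x + r *: u + r *: v) -
  g (x + r *: u) - g (x + r *: v) + g x) x u v oA Ax (cuv x Ax) (cvu x Ax)).
  by move=> r; exact: second_difference.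
move=> r r0 Ar; have [s [t [s0 t0 E]]] := second_difference Cg r0 Ar.
exists s, t; split=> //; apply: etrans E.
by rewrite (addrAC x (r *: v)); congr (_ + g x); exact: addrAC.
Qed.

Lemma derive_sym (N : nat) (A : set V) (g : V -> 'rV[R]_N) (x u v : V) :
  open A -> A x -> Ck 2 A g -> 'D_u ('D_v g) x = 'D_v ('D_u g) x.
Proof.
move=> oA Ax Cg; apply/rowP => j.
have Cj : Ck 2 A (fun z => g z 0 j : R^o) by exact: Ck_coord.
have D2 w w' : ('D_w ('D_w' g) x) 0 j = 'D_w ('D_w' (fun z => g z 0 j : R^o)) x.
  have [dg /(_ w') [dDg _]] := Cg.
  apply: etrans (esym (derive_coord w j (dDg x Ax))) _.
  apply: near_eq_derive; apply: near_open Ax => // y Ay.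
  exact: esym (derive_coord w' j (dg y Ay)).
apply: etrans (D2 u v) (etrans _ (esym (D2 v u))).
exact: derive_sym_real oA Ax Cj.
Qed.

End Schwarz.

(** * Systems of linear functionals and their smooth solutions *)

Section Functionals.
Variables (K : fieldType) (N : nat).
Local Notation T := 'rV[K]_N.

Lemma functionalE (b : T -> K^o) (w : T) : linear b ->
  b w = \sum_j w 0 j * b (delta_mx 0 j).
Proof.
move=> linb.
pose bM := GRing.isLinear.Build _ _ _ _ b linb.
pose bL : {linear T -> K^o} := HB.pack b bM.
rewrite {1}[w]row_sum_delta -[b _]/(bL _) linear_sum.
by apply: eq_bigr => j _; rewrite linearZ.
Qed.

(** In coordinates: the row [B] of [b] lies in the row space of the matrix [A]
    of the [lam i] as soon as it annihilates the columns of the cokernel of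
    [A], and these columns are common zeros of the [lam i]. *)
Lemma functional_span k (lam : 'I_k -> T -> K^o) (b : T -> K^o) :
  (forall i, linear (lam i)) -> linear b ->
  (forall w, (forall i, lam i w = 0) -> b w = 0) ->
  exists c : 'I_k -> K, forall w, b w = \sum_i c i * lam i w.
Proof.
move=> linl linb kerb.
pose A : 'M[K]_(k, N) := \matrix_(i, j) lam i (delta_mx 0 j).
pose B : 'rV[K]_N := \row_j b (delta_mx 0 j).
have AE (w : T) i : (A *m w^T) i 0 = lam i w.
  by rewrite mxE functionalE //; apply: eq_bigr => j _; rewrite !mxE mulrC.
have BE (w : T) : (B *m w^T) 0 0 = b w.
  by rewrite mxE functionalE //; apply: eq_bigr => j _; rewrite !mxE mulrC.
have /submxP [c Bc] : (B <= A)%MS.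
  rewrite submxE; apply/eqP/rowP => j; rewrite [RHS]mxE.
  have -> : (B *m cokermx A) 0 j = (B *m col j (cokermx A)) 0 0.
    by rewrite !mxE; apply: eq_bigr => l _; rewrite !mxE.
  rewrite -[col j _]trmxK BE; apply: kerb => i.
  by rewrite -AE trmxK colE mulmxA mulmx_coker mul0mx mxE.
exists (fun i => c 0 i) => w.
by rewrite -BE Bc -mulmxA mxE; apply: eq_bigr => i _; rewrite AE.
Qed.

(** The matrix of an independent family of functionals has a right inverse,
    whose columns are the wanted vectors. *)
Lemma dual_family k (lam : 'I_k -> T -> K^o) :
  (forall i, linear (lam i)) ->
  (forall c : 'I_k -> K, (forall w, \sum_i c i * lam i w = 0) ->
     forall i, c i = 0) ->
  exists b : 'I_k -> T, forall i j, lam i (b j) = (i == j)%:R.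
Proof.
move=> linl indep.
pose A : 'M[K]_(k, N) := \matrix_(i, j) lam i (delta_mx 0 j).
have AE (w : T) i : (A *m w^T) i 0 = lam i w.
  by rewrite mxE functionalE //; apply: eq_bigr => j _; rewrite !mxE mulrC.
have /row_freeP [B AB] : row_free A.
  rewrite -kermx_eq0 -submx0; apply/row_subP => l.
  have kl : row l (kermx A) *m A = 0 by rewrite -row_mul mulmx_ker row0.
  rewrite submx0; apply/eqP/rowP => i; rewrite [RHS]mxE.
  apply: (indep (fun i => row l (kermx A) 0 i)) => w.
  transitivity ((row l (kermx A) *m A *m w^T) 0 0); last by rewrite kl mul0mx mxE.
  by rewrite -mulmxA mxE; apply: eq_bigr => j _; rewrite AE.
exists (fun j => (col j B)^T) => i j.
by rewrite -AE trmxK colE mulmxA AB mul1mx mxE eqxx andbT.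
Qed.

End Functionals.

Section SmoothKernel.
Variables (R : realType) (V : normedModType R).

Lemma Ck_det k l (A : set V) (G : V -> 'M[R]_l) : open A ->
  (forall i j, Ck k A (fun y => G y i j : R^o)) ->
  Ck k A (fun y => \det (G y) : R^o).
Proof.
move=> oA CG; rewrite /determinant; apply: Ck_sum => // s.
apply: Ck_mul => //; first exact: Ck_cst.
by apply: Ck_prod => // i; exact: CG.
Qed.

Lemma Ck_adj k l (A : set V) (G : V -> 'M[R]_l) i j : open A ->
  (forall i j, Ck k A (fun y => G y i j : R^o)) ->
  Ck k A (fun y => (\adj (G y)) i j : R^o).
Proof.
move=> oA CG; under eq_fun do rewrite mxE.
apply: Ck_mul => //; first exact: Ck_cst.
apply: Ck_det => // i' j'; under eq_fun do rewrite !mxE.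
exact: CG.
Qed.

(** A zero of a smoothly varying independent system of linear equations extends
    to a smooth family of zeros. Let [b] be dual to the system at [x0] and
    [G y] the matrix of the values of the system at [y] on [b], so that
    [G x0] is the identity. Subtracting from [w0] the combination of the [b j]
    which has the same values would require the inverse of [G y]; multiplying
    by [\det (G y)] leaves only the adjugate matrix, so the result is a
    polynomial in smooth functions and solves the system at every [y], even
    where [G y] is singular. *)
Lemma smooth_kernel_extension N l (A : set V)
    (lam : V -> 'I_l -> 'rV[R]_N -> R^o) (x0 : V) (w0 : 'rV[R]_N) :
  open A -> A x0 ->
  (forall y i, A y -> linear (lam y i)) ->
  (forall i w, smooth A (fun y => lam y i w)) ->
  (forall c : 'I_l -> R, (forall w, \sum_i c i * lam x0 i w = 0) ->
     forall i, c i = 0) ->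
  (forall i, lam x0 i w0 = 0) ->
  exists2 w : V -> 'rV[R]_N, smooth A w &
    w x0 = w0 /\ forall y i, A y -> lam y i (w y) = 0.
Proof.
move=> oA Ax0 linl Cl indep lw0.
have [b lb] := dual_family (fun i => linl x0 i Ax0) indep.
pose G y : 'M[R]_l := \matrix_(j, i) lam y i (b j).
exists (fun y => \det (G y) *: w0 -
   \sum_i \sum_j (lam y i w0 * (\adj (G y)) i j) *: b j).
- move=> k.
  have CG i j : Ck k A (fun y => G y i j : R^o).
    by under eq_fun do rewrite mxE; exact: Cl.
  apply: Ck_add => //.
    apply: Ck_scale => //; [exact: Ck_det|exact: Ck_cst].
  under eq_fun do rewrite -scaleN1r.
  apply: (@Ck_scale _ _ _ _ _ (fun=> -1 : R^o)) => //; first exact: Ck_cst.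
  apply: Ck_sum => // i; apply: Ck_sum => // j; apply: Ck_scale => //.
    by apply: Ck_mul => //; [exact: Cl|exact: Ck_adj].
  exact: Ck_cst.
split=> [|y i Ay].
  have -> : G x0 = 1%:M by apply/matrixP => i j; rewrite !mxE lb eq_sym.
  rewrite det1 scale1r big1 ?subr0 // => i _.
  by rewrite big1 // => j _; rewrite lw0 mul0r scale0r.
pose LM := GRing.isLinear.Build _ _ _ _ (lam y i) (linl y i Ay).
pose L : {linear 'rV[R]_N -> R^o} := HB.pack (lam y i) LM.
rewrite -[lam y i _]/(L _) linearB linearZ linear_sum /=.
apply/eqP; rewrite subr_eq0; apply/eqP.
transitivity (\sum_l lam y l w0 * (\adj (G y) *m G y) l i).
  rewrite mul_adj_mx (bigD1 i) //= big1 => [|j ji]; last first.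
    by rewrite mxE (negbTE ji) mulr0n mulr0.
  by rewrite mxE eqxx mulr1n addr0 mulrC.
apply: eq_bigr => p _; rewrite -[lam y i _]/(L _) linear_sum mxE mulr_sumr.
apply: eq_bigr => j _; rewrite linearZ [G y j i]mxE.
exact: (@mulrA R).
Qed.

End SmoothKernel.

(** * Changes of charts and the exterior derivative *)

Section Charts.
Variables (R : realType) (N : nat) (M : manifold R N).
Implicit Types (c : chart R N M) (W : normedModType R).
Local Notation T := 'rV[R]_N.

Lemma chart_at_atlas (m : M) : atlas (chart_at m).
Proof. by rewrite /chart_at; case: cid2. Qed.

Lemma chart_at_dom (m : M) : cdom (chart_at m) m.
Proof. by rewrite /chart_at; case: cid2. Qed.

Lemma open_chart_preimage c (U : set M) :
  open U -> open (cimg c `&` cinv c @^-1` U).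
Proof.
move=> oU; rewrite openE => x [cx Ux].
rewrite /interior /=; apply: filterI.
  by apply: open_nbhs_nbhs; split => //; exact: cimg_open.
by apply: cinv_continuous => //; exact: open_nbhs_nbhs.
Qed.

Lemma near_eq_diff (V W : normedModType R) (f g : V -> W) (x v : V) :
  (\forall y \near x, f y = g y) -> differentiable f x -> 'd g x v = 'd f x v.
Proof.
move=> fg df; have dg := near_eq_differentiable fg df.
by rewrite -!deriveE //; apply/esym/near_eq_derive.
Qed.

Lemma transition_differentiable c c' x : atlas c -> atlas c' ->
  cimg c x -> cdom c' (cinv c x) -> differentiable (cmap c' \o cinv c) x.
Proof. by move=> ac ac' cx c'x; apply: (proj1 (atlas_compat ac ac' 1)). Qed.

(** The chain rule: near [x], [f \o cinv c] is [f \o cinv c'] after the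
    transition map. *)
Lemma change_chart W (f : M -> W) c c' x : atlas c -> atlas c' ->
  cimg c x -> cdom c' (cinv c x) ->
  differentiable (f \o cinv c') (cmap c' (cinv c x)) ->
  differentiable (f \o cinv c) x /\
  forall v, 'd (f \o cinv c) x v =
    'd (f \o cinv c') (cmap c' (cinv c x)) ('d (cmap c' \o cinv c) x v).
Proof.
move=> ac ac' cx c'x df.
have dt := transition_differentiable ac ac' cx c'x.
have dcomp : differentiable ((f \o cinv c') \o (cmap c' \o cinv c)) x.
  exact: differentiable_comp.
have E : \forall y \near x,
    ((f \o cinv c') \o (cmap c' \o cinv c)) y = (f \o cinv c) y.
  apply: (near_open (A := cimg c `&` cinv c @^-1` cdom c')) => //.
    by apply: open_chart_preimage; exact: cdom_open.
  by move=> y [_ c'y] /=; rewrite cmapK.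
split; first exact: near_eq_differentiable dcomp.
move=> v; apply: etrans (near_eq_diff v E dcomp) _.
exact: (congr1 (fun h : T -> W => h v) (diff_comp dt df)).
Qed.

Lemma transition_self c x v : atlas c -> cimg c x ->
  'd (cmap c \o cinv c) x v = v.
Proof.
move=> ac cx.
have di : is_diff x (id : T -> T) id by exact: is_diff_id.
rewrite (@near_eq_diff _ _ id).
- by rewrite (@diff_val _ _ _ _ _ _ _ di).
- by apply: (near_open (A := cimg c)) cx => [|y cy]; [exact: cimg_open|rewrite /= cinvK].
- exact: (@ex_diff _ _ _ _ _ _ _ di).
Qed.

Lemma transition_comp c c' c'' x v : atlas c -> atlas c' -> atlas c'' ->
  cimg c x -> cdom c' (cinv c x) -> cdom c'' (cinv c x) ->
  'd (cmap c'' \o cinv c) x v =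
  'd (cmap c'' \o cinv c') (cmap c' (cinv c x)) ('d (cmap c' \o cinv c) x v).
Proof.
move=> ac ac' ac'' cx c'x c''x.
apply: (proj2 (change_chart _ _ _ _ _)) => //.
by apply: transition_differentiable => //; [exact: cmap_img|rewrite cmapK].
Qed.

Section Pullback.
Variable theta : one_form M.
Hypothesis theta_smooth : smooth_form theta.

Lemma pullback_linear c x : linear (pullback theta c x).
Proof. by move=> a u v; rewrite /pullback !linearP. Qed.

Lemma pullback_chart_at m v :
  pullback theta (chart_at m) (cmap (chart_at m) m) v = theta m v.
Proof.
have cm := chart_at_dom m.
rewrite /pullback cmapK // transition_self //; first exact: chart_at_atlas.
exact: cmap_img.
Qed.

Lemma pullback_change c c' x v : atlas c -> atlas c' ->
  cimg c x -> cdom c' (cinv c x) ->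
  pullback theta c x v =
  pullback theta c' (cmap c' (cinv c x)) ('d (cmap c' \o cinv c) x v).
Proof.
move=> ac ac' cx c'x; rewrite /pullback cmapK //; apply: (congr1 (theta (cinv c x))).
by apply: transition_comp => //; [exact: chart_at_atlas|exact: chart_at_dom].
Qed.

(** The exterior derivative of [theta] computed with the fields that are
    constant in the chart [c]; [ext_deriv] is the case of the preferred chart
    at the point. Only the former has coefficients that can be compared from
    one point to the next. *)
Definition chart_dform c (x u v : T) : R^o :=
  'D_u (fun y => pullback theta c y v) x -
  'D_v (fun y => pullback theta c y u) x.

Lemma chart_dformC c x u v : chart_dform c x u v = - chart_dform c x v u.
Proof. by rewrite /chart_dform opprB. Qed.

Lemma pullback_differentiable c x v : atlas c -> cimg c x ->
  differentiable (fun y => pullback theta c y v) x.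
Proof. by move=> ac cx; apply: (proj1 (theta_smooth v ac 1)). Qed.

Lemma chart_dform_linearl c x v : atlas c -> cimg c x ->
  linear (fun u => chart_dform c x u v).
Proof.
move=> ac cx a u u'; rewrite /chart_dform.
have dp w := pullback_differentiable w ac cx.
have -> : (fun y => pullback theta c y (a *: u + u')) =
  (a *: (fun y => pullback theta c y u) : T -> R^o) +
  (fun y => pullback theta c y u').
  by apply/funext => y; rewrite pullback_linear.
rewrite (deriveE _ (dp v)) linearP -!(deriveE _ (dp v)).
rewrite deriveD; [|by apply: derivableZ; exact: diff_derivable|exact: diff_derivable].
rewrite deriveZ; last exact: diff_derivable.
have regroup (k p q r s : R^o) : k *: p + q - (k *: r + s) = k *: (p - r) + (q - s).
  by rewrite scalerBr opprD addrACA.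
exact: regroup.
Qed.

Lemma chart_dform_linearr c x u : atlas c -> cimg c x ->
  linear (chart_dform c x u).
Proof.
move=> ac cx a v v'.
rewrite chart_dformC [in RHS](chart_dformC c x u v) [in RHS](chart_dformC c x u).
by rewrite chart_dform_linearl // opprD -scalerN.
Qed.

(** Smoothness must be stated in one fixed chart, since the preferred chart may
    jump from point to point. *)
Lemma smooth_chart_dform k c u v : atlas c ->
  Ck k (cimg c) (fun x => chart_dform c x u v).
Proof.
move=> ac; have oc := @cimg_open _ _ _ c.
apply: Ck_add => //; first exact: (proj2 (theta_smooth v ac k.+1)).
apply: (@Ck_lin _ _ _ _ _ _ -%R) => //.
- by move=> a w w'; rewrite opprD scalerN.
- exact: opp_continuous.
- exact: (proj2 (theta_smooth u ac k.+1)).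
Qed.

(** Leibniz rule for a point-dependent functional [P] applied to a
    point-dependent vector [a]. *)
Lemma derive_pairing (V : normedModType R) (P : V -> T -> R^o) (a : V -> T)
    (x u : V) :
  (forall y, linear (P y)) -> (forall w, differentiable (P ^~ w) x) ->
  differentiable a x ->
  'D_u (fun y => P y (a y)) x = P x ('D_u a x) + 'D_u (P ^~ (a x)) x.
Proof.
move=> linP dP da.
have Ej y w : P y w = \sum_j w 0 j *: P y (delta_mx 0 j) by exact: functionalE.
pose aj j y : R^o := a y 0 j.
have daj j : differentiable (aj j) x.
  apply: (@differentiable_comp _ _ _ _ a (fun w : T => w 0 j : R^o)) => //.
  exact: differentiable_coord.
have Daj j : 'D_u (aj j) x = ('D_u a x) 0 j.
  exact: derive_coord.
have E1 : (fun y => P y (a y)) = \sum_j (fun y => aj j y *: P y (delta_mx 0 j)).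
  by apply/funext => y; rewrite Ej fct_sumE.
have E2 : P ^~ (a x) = \sum_j (fun y => aj j x *: P y (delta_mx 0 j)).
  by apply/funext => y; rewrite Ej fct_sumE.
rewrite E1 E2 !derive_sum.
- rewrite Ej -big_split /=; apply: eq_bigr => j _.
  rewrite (proj2 (scale_rule (daj j) (dP _))) addrC Daj; congr (_ + _).
  by apply/esym/deriveZ/diff_derivable.
- by move=> j; apply/derivableZ/diff_derivable.
- by move=> j; apply/diff_derivable; apply: (proj1 (scale_rule _ _)).
Qed.

(** The exterior derivative commutes with pullback. Write [t] for the transition
    map. Differentiating the coefficients of the pulled back form produces
    second derivatives of [t], symmetric by Schwarz's theorem, hence cancelled
    by the antisymmetrization; what remains is the exterior derivative in [c']
    on the images of [u] and [v]. *)
Lemma chart_dform_change c c' x u v : atlas c -> atlas c' ->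
  cimg c x -> cdom c' (cinv c x) ->
  chart_dform c x u v =
  chart_dform c' (cmap c' (cinv c x))
    ('d (cmap c' \o cinv c) x u) ('d (cmap c' \o cinv c) x v).
Proof.
move=> ac ac' cx c'x.
pose A := cimg c `&` cinv c @^-1` cdom c'.
have oA : open A by apply: open_chart_preimage; exact: cdom_open.
have Ax : A x by [].
pose t := cmap c' \o cinv c.
have st : smooth A t by exact: atlas_compat.
have [dt Dt] := st 2.
have c'tx : cimg c' (t x) by exact: cmap_img.
have D p q : 'D_p (fun y => pullback theta c y q) x =
   pullback theta c' (t x) ('D_p ('D_q t) x) +
   'D_('d t x p) (fun y => pullback theta c' y ('d t x q)) (t x).
  transitivity ('D_p (fun y => pullback theta c' (t y) ('D_q t y)) x).
    apply: near_eq_derive; apply: near_open Ax => // y [cy c'y].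
    by rewrite deriveE; [exact: pullback_change|exact: dt].
  have dP w : differentiable (fun y => pullback theta c' (t y) w) x.
    apply: (@differentiable_comp _ _ _ _ t (fun y => pullback theta c' y w)).
      exact: dt.
    exact: pullback_differentiable.
  have dDt : differentiable ('D_q t) x by exact: (proj1 (Dt q)).
  apply: etrans (derive_pairing p (fun y => pullback_linear c' (t y)) dP dDt) _.
  congr (_ + _); rewrite (deriveE q (dt _ Ax)).
  pose h y := pullback theta c' y ('d t x q).
  have dh : differentiable h (t x) by exact: pullback_differentiable.
  have dht : differentiable (h \o t) x by exact: (dP ('d t x q)).
  apply: etrans (etrans (deriveE p dht) _) (esym (deriveE ('d t x p) dh)).
  exact: (congr1 (fun k : T -> R^o => k p) (diff_comp (dt x Ax) dh)).
have cancel (p q r s : R^o) : p = r -> p + q - (r + s) = q - s.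
  by move=> ->; rewrite opprD addrACA subrr add0r.
pose H w w' := 'D_w (fun y => pullback theta c' y w') (t x).
have sym := congr1 (pullback theta c' (t x)) (derive_sym u v oA Ax (st 2)).
exact: (etrans (congr2 (fun p q : R^o => p - q) (D u v) (D v u))
  (cancel _ (H ('d t x u) ('d t x v)) _ (H ('d t x v) ('d t x u)) sym)).
Qed.

End Pullback.

Lemma Ck_diff k W (B : set T) (F : T -> W) (w : T -> T) : open B ->
  smooth B F -> smooth B w -> Ck k B (fun y => 'd F y (w y)).
Proof.
move=> oB CF Cw; have [dF DF] := CF k.+1.
apply: (@Ck_eq _ _ _ _ _ (fun y => \sum_j w y 0 j *: 'D_(delta_mx 0 j) F y)) => //.
  by move=> y By; rewrite diff_row_sum //; exact: dF.
apply: Ck_sum => // j; apply: Ck_scale => //; last exact: DF.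
by apply: Ck_coord => //; exact: Cw.
Qed.

(** The field that the chart [c] represents by [w], with its value at [p]
    converted to the preferred chart at [p], where tangent vectors live. *)
Definition chart_field c (w : T -> T) (p : M) : T :=
  'd (cmap (chart_at p) \o cinv c) (cmap c p) (w (cmap c p)).

Lemma smooth_chart_field c (U : set M) (w : T -> T) : atlas c ->
  open U -> U `<=` cdom c -> smooth (cimg c `&` cinv c @^-1` U) w ->
  smooth_vector_field U (chart_field c w).
Proof.
move=> ac oU Uc Cw c' ac' k.
pose A := cimg c' `&` cinv c' @^-1` U.
pose B := cimg c `&` cinv c @^-1` (U `&` cdom c').
have oA : open A by exact: open_chart_preimage.
have oB : open B by apply: open_chart_preimage; apply: openI => //; exact: cdom_open.
pose t := cmap c \o cinv c'.
have Ct j : Ck j A t.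
  by apply: Ck_sub (atlas_compat ac' ac j) => y [c'y /Uc Uy]; split.
have CF j : Ck j B (fun y => 'd (cmap c' \o cinv c) y (w y)).
  apply: Ck_diff => // i.
    by apply: Ck_sub (atlas_compat ac ac' i) => y [cy [Uy c'y]]; split.
  by apply: Ck_sub (Cw i) => y [cy [Uy c'y]]; split.
have AB y : A y -> B (t y).
  move=> [c'y Uy]; have cy := Uc _ Uy; split; first exact: cmap_img.
  by rewrite /t /preimage /= cmapK //; split=> //; exact: cinv_dom.
apply: Ck_eq (Ck_comp oA AB (Ct k) (CF k)) => // x [c'x Ux].
have cx := Uc _ Ux; have c'p := cinv_dom c'x.
set p := cinv c' x in cx c'p *.
have H := @transition_comp c (chart_at p) c' (cmap c p) (w (cmap c p)) ac
  (chart_at_atlas p) ac' (cmap_img cx).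
rewrite (cmapK cx) in H; exact: H (chart_at_dom p) c'p.
Qed.

End Charts.

(** * Families spanning a subspace *)

Section Families.
Variables (K : fieldType) (vT : vectType K).

Definition indep_family k (E : 'I_k -> vT) : Prop :=
  forall a : 'I_k -> K, \sum_i a i *: E i = 0 -> forall i, a i = 0.

Definition family_span k (E : 'I_k -> vT) : {vspace vT} :=
  <<[seq E i | i <- enum 'I_k]>>%VS.

Lemma family_spanE k (E : 'I_k -> vT) :
  family_span E = <<[tuple E i | i < k]>>%VS.
Proof. by []. Qed.

Lemma mem_family_span k (E : 'I_k -> vT) v : v \in family_span E ->
  exists a : 'I_k -> K, v = \sum_i a i *: E i.
Proof.
rewrite family_spanE => /coord_span ->.
exists (fun i => coord [tuple E i | i < k] i v).
by apply: eq_bigr => i _; rewrite -tnth_nth tnth_mktuple.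
Qed.

Lemma family_in_span k (E : 'I_k -> vT) i : E i \in family_span E.
Proof. by apply: memv_span; apply: map_f; rewrite mem_enum. Qed.

Lemma indep_familyP k (E : 'I_k -> vT) :
  indep_family E <-> \dim (family_span E) = k.
Proof.
have -> : \dim (family_span E) = k <-> free [tuple E i | i < k].
  by rewrite family_spanE /free size_tuple; split => [->|/eqP].
split=> [indE|/freeP freeE a aE i].
  by apply/freeP => a aE i; apply: indE; rewrite -[RHS]aE;
     apply: eq_bigr => j _; rewrite -tnth_nth tnth_mktuple.
apply: freeE; rewrite -[RHS]aE; apply: eq_bigr => j _.
by rewrite -tnth_nth tnth_mktuple.
Qed.

Lemma indep_family_spans k (E : 'I_k -> vT) (L : {vspace vT}) :
  indep_family E -> (forall i, E i \in L) -> \dim L = k -> family_span E = L.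
Proof.
move=> /indep_familyP dimE EL dimL; apply/eqP; rewrite eqEdim dimE dimL leqnn.
by rewrite andbT; apply/span_subvP => _ /mapP[i _ ->].
Qed.

Lemma subspace_family k (L : {vspace vT}) : \dim L = k ->
  exists2 E : 'I_k -> vT, indep_family E & family_span E = L.
Proof.
move=> <-; pose E i := tnth (vbasis L) i.
have spanE : family_span E = L.
  rewrite family_spanE -[RHS](span_basis (vbasisP L)); congr span.
  by congr tval; apply: eq_from_tnth => i; rewrite tnth_mktuple.
by exists E => //; apply/indep_familyP; rewrite spanE.
Qed.

End Families.

(** * Linear algebra of a contact plane *)

Section ContactAlgebra.
Variables (R : realType) (n : nat) (M : contact_manifold R n).
Local Notation T := 'rV[R]_(n.*2.+1).
Local Notation th := (@theta R n M).
Local Notation om := (@omega R n M).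
Local Notation Cm := (@contact_dist R n M).

Lemma theta_linear m : linear (th m : T -> R^o).
Proof. by move=> a u v; rewrite linearP. Qed.

Lemma omega_linearl m v : linear (fun u => om m u v : R^o).
Proof.
apply: chart_dform_linearl; first exact: theta_smooth.
  exact: chart_at_atlas.
exact/cmap_img/chart_at_dom.
Qed.

Lemma omegaC m u v : om m u v = - om m v u.
Proof. exact: chart_dformC. Qed.

Lemma omega_suml m k (a : 'I_k -> R) (E : 'I_k -> T) v :
  om m (\sum_i a i *: E i) v = \sum_i a i * om m (E i) v.
Proof.
pose LM := GRing.isLinear.Build _ _ _ _ _ (omega_linearl m v).
pose L : {linear T -> R^o} := HB.pack (fun u => om m u v : R^o) LM.
rewrite -[LHS]/(L _) linear_sum; apply: eq_bigr => i _.
by rewrite linearZ.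
Qed.

Lemma omega_sumr m k (a : 'I_k -> R) (E : 'I_k -> T) u :
  om m u (\sum_i a i *: E i) = \sum_i a i * om m u (E i).
Proof.
rewrite omegaC omega_suml -sumrN; apply: eq_bigr => i _.
by rewrite -mulrN -omegaC.
Qed.

(** The equations of the orthogonal complement, inside the contact plane, of
    the span of [E]. *)
Definition perp_functional m k (E : 'I_k -> T) (i : 'I_k.+1) (w : T) : R^o :=
  if unlift ord0 i is Some j then om m w (E j) else th m w.

Lemma perp_functional_linear m k (E : 'I_k -> T) i :
  linear (perp_functional m E i).
Proof.
rewrite /perp_functional; case: unliftP => [j|] _; last exact: theta_linear.
exact: omega_linearl.
Qed.

Lemma perp_functional_sum m k (E : 'I_k -> T) (c : 'I_k.+1 -> R) w :
  \sum_i c i * perp_functional m E i w =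
  c ord0 * th m w + \sum_j c (lift ord0 j) * om m w (E j).
Proof.
rewrite big_ord_recl /perp_functional unlift_none; congr (_ + _).
by apply: eq_bigr => j _; rewrite liftK.
Qed.

(** On the contact plane a vanishing combination is the pairing with a
    combination of the [E j], so nondegeneracy and the independence of [E] kill
    all coefficients but that of the contact form, which is nonzero. *)
Lemma perp_functional_indep m k (E : 'I_k -> T) :
  (forall i, E i \in Cm m) -> indep_family E ->
  forall c : 'I_k.+1 -> R,
    (forall w, \sum_i c i * perp_functional m E i w = 0) -> forall i, c i = 0.
Proof.
move=> EC indE c c0.
have c_lift : forall j, c (lift ord0 j) = 0.
  apply: indE; apply: (@theta_nondegenerate R n M m).
    by apply: memv_suml => j _; apply: memvZ; exact: EC.
  move=> w wC; have := c0 w; rewrite perp_functional_sum.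
  rewrite memv_ker in wC; rewrite (eqP wC) mulr0 add0r => cw.
  rewrite -[ext_deriv _ _ _ _]/(om m _ w) omegaC omega_sumr.
  by rewrite cw oppr0.
move=> i; case: (unliftP ord0 i) => [j ->|->]; first exact: c_lift.
apply/eqP; apply: contraT => c00.
case/eqP: (theta_neq0 m); apply/lfunP => w; rewrite zero_lfunE.
have := c0 w; rewrite perp_functional_sum big1 => [|j _]; last first.
  by rewrite c_lift mul0r.
by rewrite addr0 => /eqP; rewrite mulf_eq0 (negbTE c00) => /eqP.
Qed.

(** By independence, the [n.+1] equations of the orthogonal complement of [L]
    cut out a space of dimension [n.*2.+1 - n.+1 = n]. It contains [L], which
    has the same dimension, so it is [L]. *)
Lemma lagrangian_maximal m (L : {vspace T}) u : lagrangian (M := M) m L ->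
  u \in Cm m -> (forall v, v \in L -> om m u v = 0) -> u \in L.
Proof.
move=> [LC dimL LL] uC uL.
have [E indE spanE] := subspace_family dimL.
have EL i : E i \in L by rewrite -spanE family_in_span.
have EC i : E i \in Cm m by exact: subvP LC _ (EL i).
have [b lb] := dual_family (perp_functional_linear m E)
                 (perp_functional_indep EC indE).
pose F (w : T) : 'rV[R]_n.+1 := \row_i perp_functional m E i w.
have linF : linear F.
  by move=> a w w'; apply/rowP => i; rewrite !mxE perp_functional_linear.
pose FM := GRing.isLinear.Build _ _ _ _ F linF.
pose FL : {linear T -> 'rV[R]_n.+1} := HB.pack F FM.
pose phi : 'Hom(T, 'rV[R]_n.+1) := linfun FL.
have phiE w : phi w = F w by rewrite lfunE.
have kerF w : w \in Cm m -> (forall v, v \in L -> om m w v = 0) ->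
    w \in lker phi.
  move=> wC wL; rewrite memv_ker phiE; apply/eqP/rowP => i; rewrite !mxE.
  rewrite /perp_functional; case: unliftP => [j|] _; first exact: wL.
  by apply/eqP; rewrite memv_ker in wC.
have full : limg phi = fullv.
  apply/eqP; rewrite eqEsubv subvf; apply/subvP => y _.
  have -> : y = phi (\sum_j y 0 j *: b j).
    rewrite linear_sum [LHS]row_sum_delta; apply: eq_bigr => j _.
    rewrite linearZ /= phiE; congr (_ *: _).
    by apply/rowP => i; rewrite !mxE lb eqxx.
  by apply: memv_img; exact: memvf.
have dimker : \dim (lker phi) = n.
  have := limg_ker_dim phi fullv; rewrite capfv full !dimvf /dim /= !mul1n.
  move=> H; apply: (@addIn n.+1); apply: etrans H _.
  by rewrite addnS addnn.
have /eqP -> : L == lker phi.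
  rewrite eqEdim dimker dimL leqnn andbT; apply/subvP => w wL.
  by apply: kerF => [|v vL]; [exact: subvP LC _ wL|exact: LL].
exact: kerF.
Qed.

(** A functional vanishing on the common zeros of the equations of the
    complement is a combination of them; on the contact plane the contact form
    drops out, and a combination of pairings with vectors of [D m] is the
    pairing with a vector of [D m]. *)
Lemma annihilator_orth (D : M -> {vspace T}) m (b : T -> R^o) : linear b ->
  (forall u, orth (M := M) D m u -> b u = 0) ->
  exists2 d, d \in D m & forall v, v \in Cm m -> b v = om m d v.
Proof.
move=> linb kerb.
have [E _ spanE] := subspace_family (erefl (\dim (D m))).
have [|c bc] := functional_span (perp_functional_linear m E) linb.
  move=> w lw; apply: kerb; split.
    have := lw ord0; rewrite /perp_functional unlift_none => tw.
    by rewrite memv_ker tw.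
  move=> v; rewrite -spanE => /mem_family_span[a ->].
  rewrite omega_sumr big1 // => j _.
  by have := lw (lift ord0 j); rewrite /perp_functional liftK => ->; rewrite mulr0.
exists (\sum_j (- c (lift ord0 j)) *: E j).
  by apply: memv_suml => j _; apply: memvZ; rewrite -spanE family_in_span.
move=> v; rewrite memv_ker => /eqP tv.
rewrite bc perp_functional_sum tv mulr0 add0r omega_suml.
by apply: eq_bigr => j _; rewrite mulNr -mulrN -omegaC.
Qed.

End ContactAlgebra.

(** * Sections of the orthogonal distribution *)

Section OrthSections.
Variables (R : realType) (n : nat) (M : contact_manifold R n).
Local Notation T := 'rV[R]_(n.*2.+1).
Local Notation th := (@theta R n M).
Local Notation om := (@omega R n M).
Local Notation Cm := (@contact_dist R n M).

(** [perp_functional] read in one fixed chart, where it varies smoothly with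
    the point; [Y] represents a frame. *)
Definition chart_perp_functional (c : chart R n.*2.+1 M) k (Y : 'I_k -> T -> T)
    (y : T) (i : 'I_k.+1) (w : T) : R^o :=
  if unlift ord0 i is Some j then chart_dform th c y w (Y j y)
  else pullback th c y w.

Lemma smooth_chart_perp_functional c k (A : set T) (Y : 'I_k -> T -> T) i w :
  atlas c -> open A -> A `<=` cimg c -> (forall j, smooth A (Y j)) ->
  smooth A (fun y => chart_perp_functional c Y y i w).
Proof.
move=> ac oA Ac CY q; rewrite /chart_perp_functional.
case: unliftP => [j|] _; last first.
  by apply: Ck_sub Ac _; exact: theta_smooth.
apply: (@Ck_eq _ _ _ _ _ (fun y => \sum_p Y j y 0 p *
    chart_dform th c y w (delta_mx 0 p) : R^o)) => //.
  move=> y Ay; apply/esym/functionalE; apply: chart_dform_linearr => //.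
    exact: theta_smooth.
  exact: Ac.
apply: Ck_sum => // p; apply: Ck_mul => //.
  by apply: Ck_coord => //; exact: CY.
apply: Ck_sub Ac _; apply: smooth_chart_dform => //; exact: theta_smooth.
Qed.

(** The complement of [D] is again a distribution. Near [m] it is cut out, in
    the preferred chart at [m], by the contact form and the pairings with a
    local frame of [D]; these equations are independent at [m], so the solution
    [u] at [m] extends to a smooth solution. Naturality of the exterior
    derivative shows that solving the equations written in the chart at [m] is
    being orthogonal to [D] for the form written in the chart at each point. *)
Lemma orth_section (D : M -> {vspace T}) m u :
  is_distribution n D -> (forall m, (D m <= Cm m)%VS) ->
  orth (M := M) D m u ->
  exists (U : set M) (X : M -> T),
    [/\ open U, U m, section_of (orth (M := M) D) U X & X m = u].
Proof.
move=> [dimD frameD] DC [uC uD].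
have [U [X [oU Um CX spanX]]] := frameD m.
pose c := chart_at m; have ac : atlas c := chart_at_atlas m.
have cm : cdom c m := chart_at_dom m.
pose x0 := cmap c m.
pose Y j y := differential (cmap c) (cinv c y) (X j (cinv c y)).
pose A := cimg c `&` cinv c @^-1` U.
have oA : open A by exact: open_chart_preimage.
have Ax0 : A x0 by split; [exact: cmap_img|rewrite /= /preimage /= cmapK].
have CY j : smooth A (Y j) by exact: CX.
have Y0 j : Y j x0 = X j m.
  rewrite /Y /x0 cmapK // /differential; apply: transition_self => //.
  exact: cmap_img.
have lamE i w : chart_perp_functional c Y x0 i w =
    perp_functional m (fun j => X j m) i w.
  rewrite /chart_perp_functional /perp_functional.
  case: unliftP => [j|] _; last exact: pullback_chart_at.
  by rewrite Y0.
have XC j : X j m \in Cm m.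
  apply: subvP (DC m) _ _; rewrite spanX //; exact: family_in_span.
have indX : indep_family (fun j => X j m).
  by apply/indep_familyP; rewrite /family_span -spanX.
have [||||w Cw [w0 wA]] :=
    @smooth_kernel_extension R T _ _ A (chart_perp_functional c Y) x0 u oA Ax0.
- move=> y i [cy _]; rewrite /chart_perp_functional.
  case: unliftP => [j|] _; last exact: pullback_linear.
  by apply: chart_dform_linearl => //; exact: theta_smooth.
- move=> i w; apply: smooth_chart_perp_functional => //.
  by move=> y [].
- move=> a la; apply: (perp_functional_indep XC indX) => w.
  by rewrite -[RHS](la w); apply: eq_bigr => i _; rewrite lamE.
- move=> i; rewrite lamE /perp_functional; case: unliftP => [j|] _.
    by apply: uD; rewrite spanX //; exact: family_in_span.
  by apply/eqP; rewrite memv_ker in uC.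
exists (cdom c `&` U), (chart_field c w); split.
- by apply: openI => //; exact: cdom_open.
- by [].
- split.
    apply: smooth_chart_field => //.
      by apply: openI => //; exact: cdom_open.
    by move=> k; apply: Ck_sub (Cw k) => y [cy [_ Uy]]; split.
  move=> p [cp Up].
  pose y := cmap c p; have cy : cimg c y by exact: cmap_img.
  have yp : cinv c y = p by exact: cmapK.
  have Ay : A y by split; rewrite //= /preimage /= yp.
  have := wA y ^~ Ay; rewrite /chart_perp_functional => lw.
  split.
    rewrite memv_ker; apply/eqP; have := lw ord0.
    by rewrite unlift_none /pullback yp.
  move=> v; rewrite spanX // => /mem_family_span[a ->].
  rewrite omega_sumr big1 // => j _.
  (* The frame vector at [p] is recovered by going to the chart [c] and back. *)
  have Xj : X j p = 'd (cmap (chart_at p) \o cinv c) y (Y j y).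
    have [acp cpp] := (chart_at_atlas p, chart_at_dom p).
    have := @transition_comp _ _ _ (chart_at p) c (chart_at p)
      (cmap (chart_at p) p) (X j p) acp ac acp (cmap_img cpp).
    rewrite (cmapK cpp) => /(_ cp cpp) H.
    rewrite /Y yp; apply: etrans H.
    by apply/esym/transition_self => //; exact: cmap_img.
  have := lw (lift ord0 j); rewrite liftK.
  rewrite (chart_dform_change (theta_smooth (c:=M)) _ _ ac (chart_at_atlas p) cy).
    rewrite yp -Xj => H; apply: etrans (mulr0 (a j)); congr (_ * _); exact: H.
  by rewrite yp; exact: chart_at_dom.
- rewrite /chart_field; apply: etrans (transition_self _ _ _) w0 => //.
  exact: cmap_img.
Qed.

(** First integrals are only tested on sections, and every vector of the
    complement is the value of a section. *)
Lemma first_integral_orth (D : M -> {vspace T}) (f : M -> R^o) m u :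
  is_distribution n D -> (forall m, (D m <= Cm m)%VS) ->
  first_integral (orth (M := M) D) f -> orth (M := M) D m u ->
  differential f m u = 0.
Proof.
move=> distD DC [_ fX] uD.
have [U [X [oU Um secX <-]]] := orth_section distD DC uD.
exact: fX oU secX _ Um.
Qed.

Lemma differential_compose_row (phi : 'rV[R]_n -> R^o) (f : 'I_n -> M -> R^o) m v :
  smooth setT phi -> (forall i, smooth_on setT (f i)) ->
  differential (compose_row phi f) m v =
  \sum_i 'D_(delta_mx 0 i) phi (\row_i f i m) * differential (f i) m v.
Proof.
move=> Cphi Cf; pose c := chart_at m; pose x := cmap c m.
have cm : cdom c m := chart_at_dom m.
have cx : cimg c x by exact: cmap_img.
have dphi y : differentiable phi y by exact: (proj1 (Cphi 1)).
have df i : differentiable (f i \o cinv c) x.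
  by apply: (proj1 (Cf i c (chart_at_atlas m) 1)).
pose G y := \sum_i (f i (cinv c y)) *: (delta_mx 0 i : 'rV[R]_n).
have GE y : G y = \row_i f i (cinv c y).
  by rewrite [RHS]row_sum_delta; apply: eq_bigr => i _; rewrite mxE.
have dGi i : differentiable
    (fun y => f i (cinv c y) *: (delta_mx 0 i : 'rV[R]_n)) x.
  by apply: (proj1 (scale_rule (df i) (differentiable_cst _ _))).
have GS : G = \sum_i (fun y => f i (cinv c y) *: (delta_mx 0 i : 'rV[R]_n)).
  by apply/funext => y; rewrite fct_sumE.
have dG : differentiable G x by rewrite GS; exact: differentiable_sum.
have DG : 'D_v G x = \sum_i differential (f i) m v *: delta_mx 0 i.
  rewrite GS derive_sum; last by move=> i; exact: diff_derivable.
  apply: eq_bigr => i _.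
  apply: etrans (proj2 (scale_rule (df i) (differentiable_cst _ _)) v) _.
  by rewrite derive_cst scaler0 add0r deriveE.
have E : compose_row phi f \o cinv c = phi \o G.
  by apply/funext => y; rewrite /= GE.
rewrite /differential -/c -/x E.
apply: etrans (congr1 (fun h : T -> R^o => h v) (diff_comp dG (dphi _))) _.
rewrite /= -(deriveE v dG) DG linear_sum GE /x cmapK //.
apply: eq_bigr => i _; rewrite linearZ deriveE //; exact: mulrC.
Qed.

End OrthSections.

(** * Prolongations of the level sets of first integrals *)

Theorem theorem7p16 (R : realType) (n : nat) (M : contact_manifold R n)
  (D : M -> {vspace 'rV[R]_(n.*2.+1)})
  (D_dist : is_distribution n D)
  (D_sub : forall m, (D m <= contact_dist m)%VS)
  (f : 'I_n -> M -> R^o)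
  (f_integral : forall i, first_integral (orth D) (f i))
  (f_indep : independent f)
  (f_indep_contact : independent_along (@contact_dist R n M) f) :
  union_prolong f = pde_of_dist D.
Proof.
have f_smooth i : smooth_on setT (f i) by have [] := f_integral i.
have dim_D m : \dim (D m) = n by have [] := D_dist.
have df_hom i m : linear (differential (f i) m : _ -> R^o).
  by move=> a u v; rewrite /differential linearP.
(* The contact plane part of [differential (f i) m] is the pairing with a vector
   of [D m], the value at [m] of the Hamiltonian field of [f i]. *)
have ham m i : {d : 'rV[R]_(n.*2.+1) | d \in D m /\ forall v,
    v \in @contact_dist R n M m -> differential (f i) m v = @omega R n M m d v}.
  apply: cid.
  have [|d dD dE] := @annihilator_orth R n M D m _ (df_hom i m).
    by move=> u; exact: first_integral_orth.
  by exists d.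
pose d m i := sval (ham m i).
have dD m i : d m i \in D m by exact: (svalP (ham m i)).1.
have dE m i v : v \in @contact_dist R n M m ->
    differential (f i) m v = @omega R n M m (d m i) v.
  exact: (svalP (ham m i)).2.
have d_indep m : indep_family (d m).
  move=> a a0; apply: (f_indep_contact m) => v vC.
  transitivity (@omega R n M m (\sum_i a i *: d m i) v).
    by rewrite omega_suml; apply: eq_bigr => i _; rewrite dE.
  rewrite a0; have := omega_suml m (fun=> 0) (d m) v.
  by rewrite !big1 // => i _; rewrite ?scale0r ?mul0r.
have d_span m : family_span (d m) = D m by exact: indep_family_spans.
apply/seteqP; split => -[m L lagL].
  move=> [phi [Cphi hyp] [/= zero ker]].
  pose a i := 'D_(delta_mx 0 i) phi (\row_i f i m).
  have chain v : differential (compose_row phi f) m v =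
    \sum_i a i * differential (f i) m v.
    by exact: differential_compose_row.
  (* The regularity of the hypersurface at [m] makes the coefficients [a i] not
     all zero. *)
  have a_neq0 : \sum_i a i *: d m i != 0.
    apply/eqP => /d_indep a0.
    have [v] := hyp m zero; rewrite chain big1 ?eqxx // => i _.
    by rewrite a0 mul0r.
  have aD : \sum_i a i *: d m i \in D m.
    by apply: memv_suml => i _; apply: memvZ.
  have aL : \sum_i a i *: d m i \in L.
    apply: (lagrangian_maximal lagL); first exact: subvP (D_sub m) _ aD.
    move=> v vL; have [v0 vC] := ker v vL.
    rewrite omega_suml -[RHS]v0 chain.
    by apply: eq_bigr => i _; rewrite dE.
  move=> /= LD0; case/eqP: a_neq0; apply/eqP.
  by rewrite -memv0 -LD0 memv_cap aL aD.
move=> /= /eqP LD0; have [LC dimL LL] := lagL.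
have [e [eL eD e_neq0]] : exists e, [/\ e \in L, e \in D m & e != 0].
  exists (vpick (L :&: D m)%VS); rewrite vpick0 -[_ \in L]andbT.
  by have := memv_pick (L :&: D m)%VS; rewrite memv_cap => /andP[-> ->].
have [a aE] : exists a, e = \sum_i a i *: d m i.
  by apply: mem_family_span; rewrite d_span.
(* The affine function vanishing at [\row_i f i m] whose differential has
   the coefficients of [e] on the Hamiltonian vectors. *)
pose phi (y : 'rV[R]_n) : R^o := \sum_i a i * (y 0 i - f i m).
have Cphi : smooth setT phi.
  move=> k; apply: Ck_sum => [|i]; first exact: openT.
  apply: Ck_mul; [exact: openT|exact: Ck_cst|].
  apply: Ck_add; [exact: openT| |exact: Ck_cst].
  by apply: Ck_coord; [exact: openT|exact: Ck_id].
have Dphi y i : 'D_(delta_mx 0 i) phi y = a i.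
  rewrite /phi derive_affine_row (bigD1 i) //= big1 => [|j ji].
    by rewrite mxE !eqxx mulr1 addr0.
  by rewrite mxE (negbTE ji) andbF mulr0.
have chain p v : differential (compose_row phi f) p v =
    \sum_i a i * differential (f i) p v.
  by rewrite differential_compose_row //; apply: eq_bigr => i _; rewrite Dphi.
exists phi; last first.
  split=> [|v vL] /=.
    by rewrite /zero_set /compose_row /= /phi big1 // => i _; rewrite mxE subrr mulr0.
  have vC : v \in @contact_dist R n M m by exact: subvP LC _ vL.
  split=> //; rewrite /tangent_zero_set /= chain.
  rewrite -[RHS](LL _ _ eL vL) aE omega_suml.
  by apply: eq_bigr => i _; rewrite dE.
(* The level set is regular because the [f i] are independent at every point. *)
split=> // p _; apply: contrapT => /forallNP p0.
case/eqP: e_neq0; rewrite aE big1 // => i _.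
rewrite (f_indep p a) ?scale0r // => v _.
by rewrite -chain; apply/eqP; have /negP := p0 v; rewrite negbK.
Qed.
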